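(* Let $a,b,c\in\mathbb{Z}$ with $abc=0$ or $a+b+c=0$, and let $P(x,y,z)$ be either $x^2-xy+ax+by+cz$ or $x^2-y^2+ax+by+cz$. Then the following are equivalent: (1) the equation $P(x,y,z)=0$ is partition regular; (2) either $\tilde P=0$, or $P$ satisfies the minimal Rado condition.
   Context: Notation: $\mathbb{N}=\{1,2,\ldots\}$, $\mathbb{N}_0=\mathbb{N}\cup\{0\}$. For $P\in\mathbb{Z}[x_1,\ldots,x_n]$ write $P(x)=\sum_{\alpha\in\mathbb{N}_0^n}c_\alpha x^\alpha$; $\mathrm{Supp}(P)=\{\alpha:c_\alpha\ne0\}$; $|\alpha|=\sum\alpha_i$; $\alpha!=\prod\alpha_i!$; for $r\in\mathbb{Z}$, $\boldsymbol r=(r,\ldots,r)$, $P^{(r)}(x)=P(x_1+r,\ldots,x_n+r)$, whose coefficient of $x^\alpha$ is $\frac1{\alpha!}\frac{\partial^\alpha P}{\partial x^\alpha}(\boldsymbol r)$; $\tilde P(w)=P(w,\ldots,w)$. (Here $\tilde P(w)=(a+b+c)w$.) Partition regularity: the equation $P=0$ is partition regular if for every finite coloring $c:\mathbb{N}\to\{1,\ldots,k\}$ there are infinitely many sets $\{a_1,\ldots,a_n\}\subseteq\mathbb{N}$ with $P(a_1,\ldots,a_n)=0$ on which $c$ is constant. A positive linear map is $\phi(\alpha)=t_1\alpha_1+\cdots+t_n\alpha_n$ with $t_i\in\mathbb{N}_0$; it is $c$-monochromatic if $\{t_1,\ldots,t_n\}$ is. If $M_0<\cdots<M_\ell$ enumerates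 $\phi(\mathrm{Supp}(P))$, the partition determined by $\phi$ is $(J_0,\ldots,J_\ell)$, $J_i=\{\alpha\in\mathrm{Supp}(P):\phi(\alpha)=M_i\}$. A minimal (lower) Rado functional of order $m$ for $P$ is a tuple $(J_0,\ldots,J_\ell,d_1,\ldots,d_m)$, $\ell\ge m$, $d_i\in\mathbb{N}$, such that for every finite coloring $c$ of $\mathbb{N}$ and every $k\in\mathbb{N}$ there are infinitely many $c$-monochromatic positive linear maps $\phi$ determining the partition $(J_0,\ldots,J_\ell)$ with $M_i-M_0=d_i$ ($1\le i\le m$) and $M_{m+1}-M_m\ge k$. Minimal Rado condition (for $\tilde P$ nonzero splitting into linear factors over $\mathbb{Z}$): for every prime $p$ there are a root $a\in\mathbb{Z}$ of $\tilde P$ and a minimal Rado functional $(J_0,\ldots,J_\ell,d_1,\ldots,d_m)$ for $P^{(a)}$ such that, with $d_0:=0$, the equation $\sum_{i=0}^m p^{d_i}\sum_{\alpha\in J_i}\frac1{\alpha!}\frac{\partial^\alpha P}{\partial x^\alpha}(\boldsymbol a)w^{|\alpha|}=0$ has an invertible solution in the $p$-adic integers $\mathbb{Z}_p$. *)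

(* Defs.v *)
From HB Require Import structures.
From mathcomp Require Import all_boot all_order all_algebra.
From mathcomp Require Import finmap.
From mathcomp Require Import mathcomp_extra boolp classical_sets cardinality.
From mathcomp Require Import mpoly.

Set Implicit Arguments.
Unset Strict Implicit.
Unset Printing Implicit Defensive.

Import Order.TTheory GRing.Theory Num.Theory.
Local Open Scope classical_set_scope.
Local Open Scope ring_scope.

(* The ring Z_p of p-adic integers, as the inverse limit of the Z/p^n. An
   element is the sequence of its reduced residues; for p > 0 the condition
   forces 0 <= x n < p ^ n. *)
Record padic_int (p : nat) := PadicInt {
  padic_res :> nat -> int;
  padic_resP : forall n, padic_res n = (padic_res n.+1 %% (p ^ n)%N%:Z)%Z }.

Section PadicInt.
Variable p : nat.
Implicit Types x y z : padic_int p.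

Lemma padic_eqP x y : padic_res x = padic_res y -> x = y.
Proof.
case: x y => [x xP] [y yP] /= exy; case: _ / exy in yP *.
by congr PadicInt; apply: Prop_irrelevance.
Qed.

Definition coherent (f : nat -> int) :=
  forall n, (f n.+1 %% (p ^ n)%N)%Z = (f n %% (p ^ n)%N)%Z.

Lemma padic_mk_subproof f : coherent f -> forall n,
  (f n %% (p ^ n)%N)%Z = ((f n.+1 %% (p ^ n.+1)%N)%Z %% (p ^ n)%N)%Z.
Proof.
move=> fP n; rewrite -fP {1}(divz_eq (f n.+1) (p ^ n.+1)%N).
by rewrite expnS PoszM mulrA modzMDl.
Qed.

Definition padic_mk f (fP : coherent f) : padic_int p :=
  PadicInt (padic_mk_subproof fP).

Lemma padic_res_mod x n : (x n %% (p ^ n)%N)%Z = x n.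
Proof. by rewrite [in LHS]padic_resP modz_mod -padic_resP. Qed.

Lemma padic_coherent x : coherent x.
Proof. by move=> n; rewrite -padic_resP padic_res_mod. Qed.

Lemma const_coherent (m : int) : coherent (fun=> m).
Proof. by []. Qed.

Lemma opp_coherent x : coherent (fun n => - x n).
Proof. by move=> n; rewrite -modzNm padic_coherent modzNm. Qed.

Lemma add_coherent x y : coherent (fun n => x n + y n).
Proof. by move=> n; rewrite -modzDm !padic_coherent modzDm. Qed.

Lemma mul_coherent x y : coherent (fun n => x n * y n).
Proof. by move=> n; rewrite -modzMm !padic_coherent modzMm. Qed.

Definition padic_const m := padic_mk (const_coherent m).
Definition padic_opp x := padic_mk (@opp_coherent x).
Definition padic_add x y := padic_mk (@add_coherent x y).
Definition padic_mul x y := padic_mk (@mul_coherent x y).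

Lemma padic_addA : associative padic_add.
Proof.
by move=> x y z; apply/padic_eqP/funext=> n /=; rewrite modzDml modzDmr addrA.
Qed.

Lemma padic_addC : commutative padic_add.
Proof. by move=> x y; apply/padic_eqP/funext=> n /=; rewrite addrC. Qed.

Lemma padic_add0 : left_id (padic_const 0) padic_add.
Proof.
by move=> x; apply/padic_eqP/funext=> n /=; rewrite mod0z add0r padic_res_mod.
Qed.

Lemma padic_addN : left_inverse (padic_const 0) padic_opp padic_add.
Proof. by move=> x; apply/padic_eqP/funext=> n /=; rewrite modzDml addNr. Qed.

Lemma padic_mulA : associative padic_mul.
Proof.
by move=> x y z; apply/padic_eqP/funext=> n /=; rewrite modzMml modzMmr mulrA.
Qed.

Lemma padic_mulC : commutative padic_mul.
Proof. by move=> x y; apply/padic_eqP/funext=> n /=; rewrite mulrC. Qed.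

Lemma padic_mul1 : left_id (padic_const 1) padic_mul.
Proof.
by move=> x; apply/padic_eqP/funext=> n /=; rewrite modzMml mul1r padic_res_mod.
Qed.

Lemma padic_mulDl : left_distributive padic_mul padic_add.
Proof.
by move=> x y z; apply/padic_eqP/funext=> n /=; rewrite modzMml modzDm mulrDl.
Qed.

End PadicInt.

HB.instance Definition _ (p : nat) := gen_eqMixin (padic_int p).
HB.instance Definition _ (p : nat) := gen_choiceMixin (padic_int p).
HB.instance Definition _ (p : nat) := GRing.isZmodule.Build (padic_int p)
  (@padic_addA p) (@padic_addC p) (@padic_add0 p) (@padic_addN p).
(* Only a ComPzRing, since p is an arbitrary natural number and the ring is
   trivial for p = 1. *)
HB.instance Definition _ (p : nat) := GRing.Zmodule_isComPzRing.Build
  (padic_int p) (@padic_mulA p) (@padic_mulC p) (@padic_mul1 p)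
  (@padic_mulDl p).

(* Colorings are defined on all of nat; the color of 0 is never used, because
   monochromatic sets are required to consist of positive integers. *)
Definition monochromatic (k : nat) (c : nat -> 'I_k) (A : set nat) : Prop :=
  (forall x, A x -> (0 < x)%N) /\ (forall x y, A x -> A y -> c x = c y).

Definition partition_regular (n : nat) (P : {mpoly int[n]}) : Prop :=
  forall (k : nat) (c : nat -> 'I_k),
    infinite_set [set range a | a in
      [set a : 'I_n -> nat |
         monochromatic c (range a) /\ P.@[fun i => (a i)%:Z] = 0]].

Section RadoCondition.
Variables (n : nat) (P : {mpoly int[n]}).

Definition mshift (r : int) : {mpoly int[n]} :=
  P \mPo [tuple 'X_i + r%:MP | i < n].

Definition mdiag : {poly int} := mmap polyC (fun=> 'X) P.

(* The division is exact, see taylor_coefE below. *)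
Definition taylor_coef (r : int) (alpha : 'X_{1..n}) : int :=
  ((P^`M[alpha]).@[fun=> r] %/ (\prod_(i < n) (alpha i)`!)%N%:Z)%Z.

(* A positive linear map is given by its coefficients t. *)
Definition poslin (t : 'I_n -> nat) (alpha : 'X_{1..n}) : nat :=
  (\sum_(i < n) t i * alpha i)%N.

Definition levels (t : 'I_n -> nat) : seq nat :=
  sort leq (undup [seq poslin t alpha | alpha <- msupp P]).

Definition level (t : 'I_n -> nat) (i : nat) : nat := nth 0%N (levels t) i.

Definition determined_partition (t : 'I_n -> nat) : seq {fset 'X_{1..n}} :=
  [seq [fset alpha in msupp P | poslin t alpha == M]%fset | M <- levels t].

(* J = (J_0, ..., J_l) and d = (d_1, ..., d_m), so that l = (size J).-1,
   m = size d and d_(i+1) = nth 0 d i. If l = m there is no M_(m+1), and the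
   gap condition is void. *)
Definition minimal_rado_functional
    (J : seq {fset 'X_{1..n}}) (d : seq nat) : Prop :=
  [/\ (size d < size J)%N,
      all (fun e => 0 < e)%N d
    & forall (r : nat) (c : nat -> 'I_r) (k : nat),
        infinite_set [set t : 'I_n -> nat |
          [/\ monochromatic c (range t),
              determined_partition t = J,
              forall i, (i < size d)%N ->
                level t i.+1 = (level t 0 + nth 0 d i)%N
            & ((size d).+1 < size J)%N ->
                (level t (size d) + k <= level t (size d).+1)%N]]].

End RadoCondition.

Lemma mcoeff_shiftX (n : nat) (r : int) (m alpha : 'X_{1..n}) :
  (\prod_(i < n) ('X_i + r%:MP : {mpoly int[n]}) ^+ m i)@_alpha =
  \prod_(i < n) (r ^+ (m i - alpha i) *+ 'C(m i, alpha i)).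
Proof.
pose K := (mdeg m + mdeg alpha).+1.
have mK i : (m i < K)%N.
  by rewrite ltnS (leq_trans _ (leq_addr _ _)) // mdegE (bigD1 i) //= leq_addr.
have aK i : (alpha i < K)%N.
  by rewrite ltnS (leq_trans _ (leq_addl _ _)) // mdegE (bigD1 i) //= leq_addr.
pose C i j := r ^+ (m i - j) *+ 'C(m i, j).
have -> : \prod_(i < n) ('X_i + r%:MP : {mpoly int[n]}) ^+ m i =
    \prod_(i < n) \sum_(j < K) C i j *: 'X_i ^+ j.
  apply: eq_bigr => i _; rewrite addrC exprDn.
  rewrite (big_ord_widen K (fun j => ((r%:MP : {mpoly int[n]}) ^+ (m i - j) * 'X_i ^+ j) *+ 'C(m i, j))) //.
  rewrite big_mkcond; apply: eq_bigr => j _; rewrite ltnS; case: leqP => [_|ltmj].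
    by rewrite -mul_mpolyC mpolyCMn -mulrnAl rmorphXn.
  by rewrite /C bin_small // mulr0n scale0r.
rewrite bigA_distr_bigA /= raddf_sum /=.
rewrite (bigD1 [ffun i => Ordinal (aK i)]) //= [X in _ + X]big1 ?addr0.
  rewrite scaler_prod mcoeffZ -[X in _ * X@_ _]/(\prod_i 'X_i ^+ _).
  rewrite -[RHS]mulr1; congr (_ * _); first by apply: eq_bigr => i _; rewrite ffunE.
  rewrite (eq_bigr (fun i => 'X_i ^+ alpha i)) => [|i _]; last by rewrite ffunE.
  by rewrite -mpolyXE_id mcoeffX eqxx.
move=> f nef; rewrite scaler_prod mcoeffZ.
have -> : \prod_i ('X_i : {mpoly int[n]}) ^+ f i = 'X_[[multinom (f i : nat) | i < n]].
  by rewrite mpolyXE_id; apply: eq_bigr => i _; rewrite mnmE.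
rewrite mcoeffX; case: eqP => [ef|_]; last by rewrite mulr0.
case/eqP: nef; apply/ffunP => i; rewrite ffunE; apply/val_inj => /=.
by rewrite -ef mnmE.
Qed.

Lemma taylor_coefE (n : nat) (P : {mpoly int[n]}) (r : int) (alpha : 'X_{1..n}) :
  taylor_coef P r alpha = (mshift P r)@_alpha.
Proof.
rewrite /mshift comp_mpolyE raddf_sum /= /taylor_coef.
have nz : (\prod_(i < n) (alpha i)`!)%N%:Z != 0.
  by rewrite -lt0n prodn_gt0 // => i; rewrite fact_gt0.
apply: (mulIf nz); rewrite mulr_suml mderivmE raddf_sum /=.
rewrite [X in (X %/ _)%Z](_ : _ = (\sum_(m <- msupp P)
  (P@_m * \prod_(i < n) (r ^+ (m i - alpha i) *+ 'C(m i, alpha i)))) * (\prod_(i < n) (alpha i)`!)%N%:Z).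
  rewrite mulzK // mulr_suml; apply: eq_bigr => m _; rewrite mcoeffZ.
  under [in RHS]eq_bigr do rewrite tnth_mktuple.
  by rewrite mcoeff_shiftX.
rewrite mulr_suml; apply: eq_bigr => m _; rewrite mevalZ mevalX.
rewrite -!mulrA; congr (_ * _).
rewrite -[Posz _]natz !natr_prod -!big_split /=.
apply: eq_bigr => i _; rewrite mnmBE -bin_ffact natrM.
by rewrite mulrAC mulr_natl.
Qed.

Definition splits_over_int (f : {poly int}) : Prop :=
  exists (u : int) (s : seq {poly int}),
    all (fun q : {poly int} => size q == 2%N) s /\ f = u *: \prod_(q <- s) q.

Definition minimal_rado_condition (n : nat) (P : {mpoly int[n]}) : Prop :=
  [/\ mdiag P != 0, splits_over_int (mdiag P)
    & forall p : nat, prime p ->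
        exists (a : int) (J : seq {fset 'X_{1..n}}) (d : seq nat),
          [/\ root (mdiag P) a,
              minimal_rado_functional (mshift P a) J d
            & exists w : padic_int p,
                (exists v : padic_int p, w * v = 1) /\
                \sum_(i < (size d).+1)
                  (p ^ nth 0 (0 :: d) i)%N%:R *
                  \sum_(alpha <- nth fset0 J i)
                    (taylor_coef P a alpha)%:~R * w ^+ mdeg alpha = 0]].

(* Main.v *)
Require Import Defs.
From HB Require Import structures.
From mathcomp Require Import all_boot all_order all_algebra.
From mathcomp Require Import mpoly.
From mathcomp Require Import finmap boolp classical_sets cardinality.
From mathcomp Require Import zify ring.
Import Order.TTheory GRing.Theory Num.Theory.
Local Open Scope ring_scope.
Set Implicit Arguments.
Unset Strict Implicit.
Unset Printing Implicit Defensive.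

(** If [a + b + c = 0], every constant triple is a solution. Otherwise
    [abc = 0] and [0] is the only root of the diagonal polynomial.

    If [a = b = 0], both properties hold. In the Rado condition take the terms
    [x^2 - xy] (or [x^2 - y^2]) as [J_0], which cancel at [w = 1]. Solutions
    are [(x, x + cv, xv)], respectively [(x - cv, x + cv, 4xv)]; they are made
    monochromatic by Moreira's argument for [{x, x + y, xy}], which iterates
    van der Waerden's theorem inside piecewise syndetic sets.

    If [(a, b) <> (0, 0)], both properties fail. Take a prime
    [p > |a| + |b| + |c|]. When the weights [t] are positive and no weight is
    twice another, the part of [P] of lowest weight does not vanish mod [p] at
    [(w, w, w)] for any unit [w]. The parity of the 2-adic valuation colors the
    weights so that this applies to every minimal Rado functional, and applied
    to the [p]-adic valuations of [x, y, z], together with their [p]-free parts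
    mod [p], it gives a coloring without monochromatic solutions (if [p] divides
    none of [x, y, z], then [P(x, y, z)] is [(a + b + c)w] mod [p]). *)

(** * Van der Waerden's theorem *)

(* A family of [size s] monochromatic [k]-term progressions [(a, d)] of
   distinct colors, all of which would continue to the same point [f]. *)
Definition focused (T : finType) (k : nat) (chi : nat -> T) (f : nat)
    (s : seq (nat * nat)) : Prop :=
  uniq [seq chi u.1 | u <- s] /\
  forall u, u \in s -> [/\ (0 < u.2)%N, (u.1 + k * u.2)%N = f
    & forall i, (i < k)%N -> chi (u.1 + i * u.2)%N = chi u.1].

(** The bound [N] also covers [a + k * d], the point just after the last term, so that the point on
    which a progression focuses stays in range. *)
Definition mono_ap (T : Type) (k : nat) (chi : nat -> T) (N : nat) : Prop :=
  exists a d, [/\ (0 < d)%N, (a + k * d <= N)%N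
    & forall i, (i < k)%N -> chi (a + i * d)%N = chi a].

(** Induction on [r]. Color each block of length [N + 1] by its whole coloring and take a
    progression of equal blocks. Enlarging the steps of the family in the first block by the block
    distance refocuses it on the copy of [f] in block [A + k * D]; the copies of [f] in the earlier
    blocks form one more progression. Either [f] has the color of a member, which completes a longer
    progression, or this color is new. *)
Lemma color_focusing (k : nat) (T : finType) :
    (forall S : finType, exists W, forall chi : nat -> S, mono_ap k chi W) ->
  forall r, exists N, forall chi : nat -> T,
    (exists a d, [/\ (0 < d)%N, (a + k * d <= N)%N
      & forall i, (i <= k)%N -> chi (a + i * d)%N = chi a]) \/
    (exists f s, [/\ (f <= N)%N, size s = r & focused k chi f s]).
Proof.
move=> vdw; elim=> [|r [N IH]].
  by exists 0%N => chi; right; exists 0%N, [::].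
have [W HW] := vdw {ffun 'I_N.+1 -> T}.
exists ((W.+1) * N.+1)%N => chi.
have [A [D [D0 AW HA]]] :=
  HW (fun m => [ffun i : 'I_N.+1 => chi (m * N.+1 + i)%N]).
have blk i j : (i < k)%N -> (j <= N)%N ->
    chi ((A + i * D) * N.+1 + j)%N = chi (A * N.+1 + j)%N.
  move=> ik jN; have := HA i ik => /ffunP /(_ (inord j)).
  by rewrite !ffunE inordK.
have bd x y : (x <= W)%N -> (y <= N)%N -> (x * N.+1 + y <= W.+1 * N.+1)%N.
  by move=> xW yN; rewrite mulSn addnC leq_add // ?leq_mul // ltnW.
have AW' : (A <= W)%N by apply: leq_trans AW; apply: leq_addr.
have [[a [d [d0 ad ha]]]|[f [s [fN ss [us hs]]]]] :=
  IH (fun j => chi (A * N.+1 + j)%N).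
  left; exists (A * N.+1 + a)%N, d; split=> //.
    by rewrite -addnA bd.
  by move=> i ik; rewrite -addnA ha.
have [[u us' cu]|nf] := pselect (exists2 u, u \in s &
    chi (A * N.+1 + f)%N = chi (A * N.+1 + u.1)%N).
  left; case: (hs _ us') => u0 uf hu.
  exists (A * N.+1 + u.1)%N, u.2; split=> //; first by rewrite -addnA uf bd.
  move=> i; rewrite leq_eqVlt => /orP[/eqP->|ik]; rewrite -addnA ?uf //.
  exact: hu.
right; exists ((A + k * D) * N.+1 + f)%N.
exists ((A * N.+1 + f, D * N.+1)%N ::
  [seq (A * N.+1 + u.1, u.2 + D * N.+1)%N | u <- s]).
split; first exact: bd.
  by rewrite /= size_map ss.
split=> /=.
  rewrite -map_comp us andbT; apply/negP=> /mapP[u us' /= cu].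
  by apply: nf; exists u.
move=> u; rewrite inE => /orP[/eqP-> /=|/mapP[v vs ->] /=].
  split; [by rewrite muln_gt0 D0 | ring |] => i ik.
  have -> : (A * N.+1 + f + i * (D * N.+1) = (A + i * D) * N.+1 + f)%N by ring.
  exact: blk.
case: (hs _ vs) => v0 vf hv; split.
- by rewrite addn_gt0 v0.
- by rewrite -vf; ring.
move=> i ik.
have -> : (A * N.+1 + v.1 + i * (v.2 + D * N.+1) =
  (A + i * D) * N.+1 + (v.1 + i * v.2))%N by ring.
rewrite blk // ?hv //; apply: leq_trans fN; rewrite -vf leq_add2l leq_mul2r.
by rewrite (ltnW ik) orbT.
Qed.

(** Induction on the length. A focused family cannot have more colors than [T] has elements, so for
    [r = #|T| + 1] focusing must yield the longer progression. *)
Lemma van_der_waerden (k : nat) (T : finType) :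
  exists W, forall chi : nat -> T, mono_ap k chi W.
Proof.
elim: k T => [|[|k] IH] T.
- by exists 0%N => chi; exists 0%N, 1%N.
- exists 1%N => chi; exists 0%N, 1%N; split=> // i.
  by rewrite ltnS leqn0 => /eqP->.
have [N HN] := @color_focusing k.+1 T IH #|T|.+1.
(* [mono_ap] bounds one point beyond the last term; the second [N] pays for that extra step, as
   [d <= N]. *)
exists (N + N)%N => chi.
have [[a [d [d0 ad ha]]]|[f [s [_ ss [us _]]]]] := HN chi.
  exists a, d; split=> //.
  by move: ad; clear; nia.
have := max_card (mem [seq chi u.1 | u <- s]).
by rewrite (card_uniqP us) size_map ss ltnn.
Qed.

(** * Piecewise syndetic sets and Moreira's pattern *)

Definition dense_on (A : int -> Prop) (b : nat) (u : int) (L : nat) : Prop :=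
  forall v, u <= v -> v + b%:Z <= u + L%:Z ->
    exists x, [/\ A x, v <= x & x < v + b%:Z].

(** The sets consist of integers, so that shifts by negative numbers need no side condition. *)
Definition piecewise_syndetic (A : int -> Prop) : Prop :=
  exists b, forall L, exists u, dense_on A b u L.

Lemma piecewise_syndetic_sub (A B : int -> Prop) :
  (forall x, A x -> B x) -> piecewise_syndetic A -> piecewise_syndetic B.
Proof.
move=> AB [b HA]; exists b => L; have [u Hu] := HA L; exists u => v uv vL.
by have [x [/AB Bx ? ?]] := Hu v uv vL; exists x.
Qed.

Lemma piecewise_syndetic_inhabited (A : int -> Prop) :
  piecewise_syndetic A -> exists x, A x.
Proof.
move=> [b HA]; have [u Hu] := HA b.
by have [x [Ax _ _]] := Hu u (lexx _) (lexx _); exists x.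
Qed.

Lemma piecewise_syndetic_pos : piecewise_syndetic (fun x => 0 < x).
Proof.
exists 1%N => L; exists 1 => v v1 _; exists v; split; lia.
Qed.

(* Either [A] misses arbitrarily long stretches of the windows on which
   [A \/ B] is dense, and then [B] is dense there, or [A] itself is dense. *)
Lemma piecewise_syndetic_or (A B : int -> Prop) :
  piecewise_syndetic (fun x => A x \/ B x) ->
  piecewise_syndetic A \/ piecewise_syndetic B.
Proof.
move=> [b HAB].
have [avoid|/existsNP[L' HL']] := pselect (forall L, exists u,
    dense_on (fun x => A x \/ B x) b u L /\
    forall x, u <= x -> x < u + L%:Z -> ~ A x).
  right; exists b => L; have [u [Hu nA]] := avoid L; exists u => v uv vL.
  have [x [[Ax|Bx] vx xb]] := Hu v uv vL; last by exists x.
  by exfalso; apply: (nA x) => //; lia.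
left; exists L' => L; have [u Hu] := HAB L; exists u => v uv vL.
apply: contrapT => nx; apply: HL'; exists v; split.
  by move=> w vw wL; apply: Hu; lia.
by move=> x vx xL Ax; apply: nx; exists x.
Qed.

Lemma piecewise_syndetic_exists (T : finType) (A : T -> int -> Prop) :
  piecewise_syndetic (fun x => exists t, A t x) ->
  exists t, piecewise_syndetic (A t).
Proof.
move=> HA.
have {HA}: piecewise_syndetic (fun x => exists2 t, t \in enum T & A t x).
  apply: piecewise_syndetic_sub HA => x [t Atx]; exists t => //.
  by rewrite mem_enum.
elim: (enum T) => [|t s IH] HA.
  by have [x [t]] := piecewise_syndetic_inhabited HA.
have: piecewise_syndetic (fun x => A t x \/ exists2 t', t' \in s & A t' x).
  apply: piecewise_syndetic_sub HA => x [t'].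
  rewrite inE => /orP[/eqP->|t's Ax]; [by left | by right; exists t'].
by case/piecewise_syndetic_or => [|/IH//]; exists t.
Qed.

Lemma piecewise_syndetic_dilate (A : int -> Prop) (n : nat) : (0 < n)%N ->
  piecewise_syndetic A ->
  piecewise_syndetic (fun x => exists2 y, A y & x = n%:Z * y).
Proof.
move=> n0 [b HA]; exists (n * b + n)%N => L; have [u Hu] := HA L.
exists (n%:Z * u) => v uv vL.
(* [w] is [v / n] rounded up; the summand [n] in the gap length absorbs the rounding. *)
pose w := ((v + n%:Z - 1) %/ n%:Z)%Z.
have e := divz_eq (v + n%:Z - 1) n%:Z.
have r0 : 0 <= ((v + n%:Z - 1) %% n%:Z)%Z by apply: modz_ge0; lia.
have rn : ((v + n%:Z - 1) %% n%:Z)%Z < n%:Z by apply: ltz_pmod; lia.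
rewrite -/w in e.
have [x [Ax wx xb]] : exists x, [/\ A x, w <= x & x < w + b%:Z].
  apply: Hu; nia.
by exists (n%:Z * x); split; [exists x | nia | nia].
Qed.

(** In a window, color each position by the distance to an element of [A] shortly after it. A
    monochromatic progression of [2m + 1] positions, translated by the common distance, lies in [A],
    and its middle term is the required point. Its step is at most [W], so a single step works on a
    piecewise syndetic set. *)
Lemma piecewise_syndetic_shift (F : seq int) (A : int -> Prop) :
  piecewise_syndetic A ->
  exists2 n : nat, (0 < n)%N &
    piecewise_syndetic (fun x => forall f, f \in F -> A (x + f * n%:Z)).
Proof.
move=> [b HA].
have [m Fm] : exists m : nat, forall f, f \in F -> `|f| <= m%:Z.
  elim: F => [|g F [m IH]]; first by exists 0%N.
  exists (maxn m `|g|%N) => f; rewrite inE => /orP[/eqP->|/IH]; lia.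
have [W HW] := van_der_waerden (m + m).+1 'I_b.+1.
suff: piecewise_syndetic (fun x => exists n : 'I_W.+1, (0 < n)%N /\
    forall f, f \in F -> A (x + f * n%:Z)).
  case/piecewise_syndetic_exists => n Hn.
  have [x [n0 _]] := piecewise_syndetic_inhabited Hn.
  by exists n => //; apply: piecewise_syndetic_sub Hn => y [].
exists (b + W)%N => L; have [u Hu] := HA L; exists u => v uv vL.
have hit i : exists g : 'I_b.+1, (i <= W)%N -> A (v + i%:Z + g%:Z).
  have [iW|] := leqP i W; last by exists ord0.
  have [||x [Ax vx xb]] := Hu (v + i%:Z); [lia | lia |].
  have xlt : (absz (x - (v + i%:Z))%R < b.+1)%N by lia.
  exists (Ordinal xlt) => _ /=.
  by rewrite (_ : _ + _ = x) //; lia.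
have [chi Hchi] := choice hit.
have [a [d [d0 ad ha]]] := HW chi.
have dW : (d < W.+1)%N by nia.
have gb := ltn_ord (chi a).
exists (v + a%:Z + (chi a)%:Z + m%:Z * d%:Z); split; [|nia|nia].
exists (Ordinal dW); split=> //= f /Fm fm.
have fi : (absz (m%:Z + f)%R < (m + m).+1)%N by lia.
have := Hchi (a + absz (m%:Z + f)%R * d)%N.
rewrite ha //.
have -> : (a + absz (m%:Z + f)%R * d)%N%:Z = a%:Z + (m%:Z + f) * d%:Z.
  rewrite PoszD PoszM gez0_abs //; lia.
move=> HA'.
rewrite (_ : _ + _ = v + (a%:Z + (m%:Z + f) * d%:Z) + (chi a)%:Z); last by ring.
by apply: HA'; nia.
Qed.

(* Moreira's iteration: [B] is contained in the dilate by [y] of the color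
   class [t] for each [(y, t)] in the history [h]; when a new dilate falls in
   a color class already visited, the two visits give the pattern. *)
Lemma monochromatic_affine_pattern (T : finType) (c : int -> T) (q : nat)
    (F : seq int) : (0 < q)%N ->
  exists x v : int, [/\ 0 < x, 0 < v, c (q%:Z * x * v) = c x
    & forall f, f \in F -> 0 < x + f * v /\ c (x + f * v) = c x].
Proof.
move=> q0; apply: contrapT => nopat.
suff step r : exists (B : int -> Prop) (h : seq (nat * T)),
    [/\ piecewise_syndetic B, size h = r, uniq [seq u.2 | u <- h],
        forall x, B x -> 0 < x
      & forall u, u \in h -> (0 < u.1)%N /\ forall b, B b ->
        exists x, [/\ b = u.1%:Z * x, 0 < x & c x = u.2]].
  have [B [h [_ sh uh _ _]]] := step #|T|.+1.
  have := max_card (mem [seq u.2 | u <- h]).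
  by rewrite (card_uniqP uh) size_map sh ltnn.
elim: r => [|r [B [h [psB sh uh Bpos hB]]]].
  by exists (fun x => 0 < x), [::]; split=> //; apply: piecewise_syndetic_pos.
(* For an earlier dilation factor [y], [y * (x + f * (y * v)) = y * x + f * y^2 * v], which explains
   the factors [y^2]. The shift [0] keeps [D] inside [B]. *)
have [v v0 psD] := piecewise_syndetic_shift
  (0 :: [seq f * (u.1%:Z * u.1%:Z) | u <- h, f <- F]) psB.
set D := (fun x => _) in psD.
have qv0 : (0 < q * v)%N by rewrite muln_gt0 q0.
have DB x : D x -> B x.
  by move=> /(_ 0); rewrite inE eqxx mul0r addr0; apply.
have psqD := piecewise_syndetic_dilate qv0 psD.
have [t pst] : exists t, piecewise_syndetic (fun b =>
    (exists2 y, D y & b = (q * v)%N%:Z * y) /\ c b = t).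
  apply: piecewise_syndetic_exists.
  by apply: piecewise_syndetic_sub psqD => b Hb; exists (c b).
exists (fun b => (exists2 y, D y & b = (q * v)%N%:Z * y) /\ c b = t).
exists ((1%N, t) :: [seq ((q * v * u.1)%N, u.2) | u <- h]).
have pos b : (exists2 y, D y & b = (q * v)%N%:Z * y) -> 0 < b.
  by case=> y /DB/Bpos y0 ->; rewrite mulr_gt0 //; lia.
split=> //.
- by rewrite /= size_map sh.
(* If [t] was already visited with factor [y], then [b' = y * x] and [b = q * v * b'], so [x] and
   [y * v] form the excluded pattern. *)
- rewrite /= -map_comp uh andbT; apply/negP => /mapP[[y t'] uin /= ett].
  have [/= y0 Hy] := hB _ uin.
  have [b [[b' Db' eb] cb]] := piecewise_syndetic_inhabited pst.
  have [x [eb' x0 cx]] := Hy _ (DB _ Db').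
  apply: nopat; exists x, (y%:Z * v%:Z); split=> //; first by nia.
    rewrite cx -ett -cb; congr (c _); rewrite eb eb' PoszM; ring.
  move=> f fF.
  have : B (b' + f * (y%:Z * y%:Z) * v%:Z).
    apply: Db'; rewrite inE; apply/orP; right.
    by apply/allpairsP; exists ((y, t'), f).
  case/Hy => x' [e x'0 cx']; suff -> : x + f * (y%:Z * v%:Z) = x'.
    by rewrite cx' cx.
  have y1 : y%:Z != 0 by lia.
  by apply: (mulfI y1); rewrite -e eb'; ring.
- by move=> b [/pos].
move=> u; rewrite inE => /orP[/eqP-> /=|/mapP[w win ->] /=].
  by split=> // b [/pos b0 cb]; exists b; rewrite mul1r.
have [w0 Hw] := hB _ win; split; first by rewrite muln_gt0 qv0.
move=> b [[y /DB/Hw [x [-> x0 cx]] ->] _]; exists x; split=> //.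
by rewrite !PoszM; ring.
Qed.

(** * Leading forms *)

Section ResidueField.
Variables (p : nat) (p_pr : prime p).

Lemma intr_Fp_eq0 (z : int) : (z%:~R == 0 :> 'F_p) = (p %| `|z|)%N.
Proof.
have h n : (n%:R == 0 :> 'F_p) = (p %| n)%N.
  by rewrite (dvdn_pcharf (pchar_Fp p_pr)).
by case: z => n; rewrite ?NegzE ?mulrNz ?oppr_eq0 h // abszN.
Qed.

Lemma intr_modz_Fp (z : int) : (z %% p)%Z%:~R = z%:~R :> 'F_p.
Proof.
rewrite [in RHS](divz_eq z p) [RHS]intrD [X in _ = X + _]intrM.
have /eqP -> : p%:Z%:~R == 0 :> 'F_p by rewrite intr_Fp_eq0.
by rewrite mulr0 add0r.
Qed.

(* The primality proof is an argument so that the ring morphism instances,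
   which need it, can be inferred. *)
Definition padic_modp of prime p := fun x : padic_int p => (x 1%N)%:~R : 'F_p.

Lemma padic_modp_is_zmod_morphism : zmod_morphism (padic_modp p_pr).
Proof.
move=> x y; rewrite /padic_modp /= expn1 intr_modz_Fp intrD intr_modz_Fp.
by rewrite mulrNz.
Qed.

Lemma padic_modp_is_monoid_morphism : monoid_morphism (padic_modp p_pr).
Proof.
split; first by rewrite /padic_modp /= expn1 intr_modz_Fp.
by move=> x y; rewrite /padic_modp /= expn1 intr_modz_Fp intrM.
Qed.

HB.instance Definition _ := GRing.isZmodMorphism.Build _ _ (padic_modp p_pr)
  padic_modp_is_zmod_morphism.
HB.instance Definition _ := GRing.isMonoidMorphism.Build _ _ (padic_modp p_pr)
  padic_modp_is_monoid_morphism.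

End ResidueField.

Section LeadingForm.
Variable n : nat.
Implicit Types (P : {mpoly int[n]}) (t : 'I_n -> nat).

(* The [J_0] term of the equation in the minimal Rado condition. *)
Definition leading_form P t (R : pzRingType) (w : R) : R :=
  \sum_(alpha <- msupp P | poslin t alpha == level P t 0)
    (P@_alpha)%:~R * w ^+ mdeg alpha.

Lemma level0P P t : P != 0 ->
  (exists2 alpha, alpha \in msupp P & poslin t alpha = level P t 0) /\
  forall alpha, alpha \in msupp P -> (level P t 0 <= poslin t alpha)%N.
Proof.
move=> P0; have memE x : (x \in levels P t) =
    (x \in [seq poslin t alpha | alpha <- msupp P]).
  by rewrite mem_sort mem_undup.
have lev_sorted : sorted leq (levels P t) by apply: sort_sorted leq_total _.
have lev0 : level P t 0 \in levels P t.
  rewrite mem_nth // lt0n size_eq0; apply/eqP => lev_nil.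
  have := P0; rewrite -msupp_eq0; case: (msupp P) memE => [//|alpha s] memE.
  by have := memE (poslin t alpha); rewrite lev_nil map_f // mem_head.
split=> [|alpha Pa].
  by move: lev0; rewrite memE => /mapP[alpha Pa ->]; exists alpha.
have /(nthP 0%N)[i ilt <-] : poslin t alpha \in levels P t.
  by rewrite memE map_f.
apply: (sorted_leq_nth leq_trans leqnn 0%N lev_sorted) => //.
by rewrite inE (leq_ltn_trans _ ilt).
Qed.

(** The term of exponent [alpha] is divisible by [p ^ poslin t alpha]. After division by the lowest
    such power, only the terms of lowest weight survive mod [p]. *)
Lemma meval_prime_power P t (u : 'I_n -> nat) (p : nat) (w : 'F_p) :
    prime p -> P != 0 -> (forall i, (u i)%:R = w) ->
  P.@[fun i => (p ^ t i * u i)%N%:Z] = 0 -> leading_form P t w = 0.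
Proof.
move=> p_pr P0 uw; have [_ lev_min] := level0P t P0.
set L := level P t 0 in lev_min *.
have -> : P.@[fun i => (p ^ t i * u i)%N%:Z] = (p ^ L)%N%:Z *
    \sum_(alpha <- msupp P) P@_alpha *
      ((p ^ (poslin t alpha - L))%N%:Z * \prod_i (u i)%:Z ^+ alpha i).
  rewrite mevalE mulr_sumr big_seq [RHS]big_seq; apply: eq_bigr => alpha Pa.
  rewrite [RHS]mulrCA; congr (_ * _); rewrite mulrA -PoszM -expnD.
  rewrite subnKC ?lev_min // /poslin expn_sum -[Posz (\prod_i _)]natz.
  rewrite natr_prod -big_split /=; apply: eq_bigr => i _.
  by rewrite PoszM exprMn expnM natrX natz.
move/eqP; rewrite mulf_eq0 => /orP[|/eqP/(congr1 (fun z => z%:~R : 'F_p))].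
  by rewrite eqz_nat expn_eq0 => /andP[/eqP p0]; rewrite p0 in p_pr.
rewrite mulr0z => <-; rewrite /leading_form big_mkcond rmorph_sum /=.
apply: eq_big_seq => alpha Pa; rewrite !intrM rmorph_prod /= mdegE.
rewrite -[in LHS]prodrXr.
case: eqP => [->|/eqP ne]; last first.
  have : (p ^ (poslin t alpha - L))%N%:Z%:~R == 0 :> 'F_p.
    rewrite intr_Fp_eq0 // dvdn_exp // subn_gt0 ltn_neqAle lev_min // andbT.
    by rewrite eq_sym.
  by move/eqP->; rewrite mul0r mulr0.
rewrite subnn expn0 mul1r; congr (_ * _); apply: eq_bigr => i _.
by rewrite rmorphXn /= -pmulrn uw.
Qed.

Lemma mshift0 P : mshift P 0 = P.
Proof.
rewrite /mshift (_ : [tuple _ | i < n] = [tuple 'X_i | i < n]) ?comp_mpoly_id //.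
by apply: eq_from_tnth => i; rewrite !tnth_mktuple mpolyC0 addr0.
Qed.

Definition parity_coloring (m : nat) : 'I_2 := inord (odd (logn 2 m)).

Lemma parity_coloring_double m m' :
  (0 < m)%N -> (0 < m')%N -> parity_coloring m = parity_coloring m' ->
  m' <> (2 * m)%N.
Proof.
move=> m0 m'0 /(congr1 (@nat_of_ord 2)).
rewrite !inordK; try by case: odd.
move=> e m'E; move: e; rewrite m'E lognM // (logn_prime 2 (isT : prime 2)).
by rewrite add1n /=; case: odd.
Qed.

(** Reduction mod [p] kills the terms with [i > 0], since every [d_i] is positive, and leaves the
    sum over [J_0]. Applied to [parity_coloring], the functional supplies weights none of which is
    twice another. *)
Lemma rado_leading_form P p (p_pr : prime p) J d (w : padic_int p) :
    P != 0 -> minimal_rado_functional P J d -> (exists v, w * v = 1) ->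
    \sum_(i < (size d).+1) (p ^ nth 0 (0 :: d)%N i)%N%:R *
      \sum_(alpha <- nth fset0 J i)
        (taylor_coef P 0 alpha)%:~R * w ^+ mdeg alpha = 0 ->
  exists t (w : 'F_p), [/\ w != 0, forall i, (0 < t i)%N,
    forall i j, t j <> (2 * t i)%N & leading_form P t w = 0].
Proof.
move=> P0 [dJ d_gt0 /(_ _ parity_coloring 0%N)] /infinite_setN0[t].
case=> -[tpos tmono] tJ _ _ [v wv] Hsum.
have t0 i : (0 < t i)%N by apply: tpos; exists i.
exists t, (padic_modp p_pr w); split=> //.
- apply/eqP => w0; have /eqP := congr1 (padic_modp p_pr) wv.
  by rewrite rmorphM rmorph1 /= w0 mul0r eq_sym oner_eq0.
- move=> i j; apply: parity_coloring_double => //.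
  by apply: tmono; [exists i | exists j].
have := congr1 (padic_modp p_pr) Hsum; rewrite rmorph0 rmorph_sum /=.
rewrite big_ord_recl [X in _ + X]big1 => [|i _]; last first.
  rewrite rmorphM rmorph_nat /= -[_%:R]/(_%:Z%:~R).
  have : (p ^ nth 0 d i)%N%:Z%:~R == 0 :> 'F_p.
    by rewrite intr_Fp_eq0 // dvdn_exp // (allP d_gt0) // mem_nth.
  by move/eqP->; rewrite mul0r.
rewrite addr0 /= expn0 mul1r => <-; rewrite rmorph_sum /=.
have -> : nth fset0 J 0 =
    [fset alpha in msupp P | poslin t alpha == level P t 0]%fset.
  rewrite -tJ /determined_partition (nth_map 0%N) //.
  have -> : size (levels P t) = size J by rewrite -tJ size_map.
  exact: leq_ltn_trans dJ.
rewrite /leading_form -[LHS]big_filter.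
under [RHS]eq_bigr do rewrite rmorphM rmorph_int rmorphXn taylor_coefE mshift0.
apply: perm_big; apply: uniq_perm; rewrite ?filter_uniq ?fset_uniq //.
by move=> alpha; rewrite mem_filter !inE andbC.
Qed.

End LeadingForm.

(** * The two families of quadrics *)

Local Notation o0 := (@Ordinal 3 0 isT).
Local Notation o1 := (@Ordinal 3 1 isT).
Local Notation o2 := (@Ordinal 3 2 isT).

Section Quadric.

Lemma big_I3 (R : Type) (idx : R) (op : Monoid.law idx) (F : 'I_3 -> R) :
  \big[op/idx]_(i < 3) F i = op (F o0) (op (F o1) (F o2)).
Proof.
rewrite !big_ord_recl big_ord0 Monoid.mulm1.
by congr (op (F _) (op (F _) (F _))); apply: val_inj.
Qed.

Definition mon (i j k : nat) : 'X_{1..3} :=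
  [multinom nth 0%N [:: i; j; k] l | l < 3].

Lemma mon_eq i j k i' j' k' :
  (mon i j k == mon i' j' k') = [&& i == i', j == j' & k == k'].
Proof.
apply/eqP/and3P => [/mnmP e|[/eqP-> /eqP-> /eqP->] //].
by split; [have := e o0 | have := e o1 | have := e o2]; rewrite !mnmE /= => ->.
Qed.

Lemma poslin_mon (t : 'I_3 -> nat) i j k :
  poslin t (mon i j k) = (t o0 * i + (t o1 * j + t o2 * k))%N.
Proof. by rewrite /poslin big_I3 !mnmE. Qed.

Lemma mdeg_mon i j k : mdeg (mon i j k) = (i + (j + k))%N.
Proof. by rewrite mdegE big_I3 !mnmE. Qed.

Lemma meval_mon (R : comNzRingType) (v : 'I_3 -> R) i j k :
  'X_[mon i j k].@[v] = v o0 ^+ i * (v o1 ^+ j * v o2 ^+ k).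
Proof. by rewrite mevalX big_I3 !mnmE. Qed.

Lemma mpolyX_mon i j k : 'X_[mon i j k] =
  'X_o0 ^+ i * ('X_o1 ^+ j * 'X_o2 ^+ k) :> {mpoly int[3]}.
Proof. by rewrite mpolyXE_id big_I3 !mnmE. Qed.

(** [M] stands for [xy] or [y^2], so that both families are treated together. *)
Definition quadric (M : 'X_{1..3}) (a b c : int) : {mpoly int[3]} :=
  'X_[mon 2 0 0] - 'X_[M] + a *: 'X_[mon 1 0 0] + b *: 'X_[mon 0 1 0]
    + c *: 'X_[mon 0 0 1].

Variables (M : 'X_{1..3}) (a b c : int).
Hypothesis MP : M = mon 1 1 0 \/ M = mon 0 2 0.
Local Notation P := (quadric M a b c).

Lemma mcoeff_quadric alpha : P@_alpha =
  (mon 2 0 0 == alpha)%:R - (M == alpha)%:R + a * (mon 1 0 0 == alpha)%:R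
    + b * (mon 0 1 0 == alpha)%:R + c * (mon 0 0 1 == alpha)%:R.
Proof. by rewrite !(mcoeffD, mcoeffN, mcoeffZ, mcoeffX). Qed.

Definition quadric_monomials :=
  [:: mon 2 0 0; M; mon 1 0 0; mon 0 1 0; mon 0 0 1].

Lemma uniq_quadric_monomials : uniq quadric_monomials.
Proof.
by rewrite /quadric_monomials; case: MP => -> /=; rewrite !inE !mon_eq.
Qed.

Lemma quadric_coefs : [/\ P@_(mon 2 0 0) = 1, P@_M = -1,
  P@_(mon 1 0 0) = a, P@_(mon 0 1 0) = b & P@_(mon 0 0 1) = c].
Proof.
split; rewrite mcoeff_quadric; case: MP => ->; rewrite ?eqxx !mon_eq /=; ring.
Qed.

Lemma msupp_quadric : {subset msupp P <= quadric_monomials}.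
Proof.
move=> alpha; rewrite mcoeff_msupp; apply: contraR.
rewrite !inE !negb_or => /and5P[n1 n2 n3 n4 n5].
rewrite mcoeff_quadric ![_ == alpha]eq_sym.
rewrite (negPf n1) (negPf n2) (negPf n3) (negPf n4) (negPf n5).
by apply/eqP; rewrite /=; ring.
Qed.

Lemma quadric_neq0 : P != 0.
Proof.
apply/eqP => P0; case: quadric_coefs => + _ _ _ _.
by rewrite P0 mcoeff0.
Qed.

Lemma mdiag_quadric : mdiag P = (a + b + c)%:P * 'X.
Proof.
have mX m : mmap polyC (fun=> 'X) ('X_[m] : {mpoly int[3]}) = 'X^(mdeg m).
  by rewrite mmapX /mmap1 prodrXr mdegE.
have dM : mdeg M = 2%N by case: MP => ->; rewrite mdeg_mon.
rewrite /mdiag !(mmapD, mmapN, mmapZ, mX) dM !mdeg_mon subrr add0r.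
by rewrite !rmorphD /= !mulrDl.
Qed.

Lemma leading_form_quadric t (R : pzRingType) (w : R) :
  leading_form P t w =
  \sum_(alpha <- quadric_monomials | poslin t alpha == level P t 0)
    (P@_alpha)%:~R * w ^+ mdeg alpha.
Proof.
rewrite [RHS](bigID (mem (msupp P))) /= [X in _ = _ + X]big1 ?addr0; last first.
  by move=> alpha /andP[_ /memN_msupp_eq0 ->]; rewrite mul0r.
rewrite /leading_form -[LHS]big_filter -[RHS]big_filter.
apply: perm_big; apply: uniq_perm.
- exact: filter_uniq.
- by rewrite filter_uniq // uniq_quadric_monomials.
move=> alpha; rewrite !mem_filter -andbA; case: eqP => //= _.
case Pa : (alpha \in msupp P) => //=.
by rewrite msupp_quadric.
Qed.

Lemma leading_form_quadricE t (R : pzRingType) (w : R) (L := level P t 0) :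
  leading_form P t w =
    (t o0 * 2 == L)%:R * w ^+ 2 - (poslin t M == L)%:R * w ^+ 2
    + ((t o0 == L)%:R * a + (t o1 == L)%:R * b + (t o2 == L)%:R * c)%:~R * w.
Proof.
have [e1 e2 e3 e4 e5] := quadric_coefs.
have dM : mdeg M = 2%N by case: MP => ->; rewrite mdeg_mon.
rewrite leading_form_quadric big_mkcond /= !big_cons big_nil.
rewrite e1 e2 e3 e4 e5 dM !mdeg_mon !poslin_mon -/L !muln0 !addn0 !add0n !muln1.
do 5 case: (_ == L); rewrite ?mul1r ?mul0r ?addr0 ?add0r ?sub0r ?intrD ?mulrDl;
  by rewrite ?mulrN1z ?mulN1r ?oppr0 ?expr1 ?mulr0z ?addr0 ?add0r ?addrA.
Qed.
End Quadric.

Local Open Scope classical_set_scope.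

Lemma forall_I3 (Q : 'I_3 -> Prop) : Q o0 -> Q o1 -> Q o2 -> forall i, Q i.
Proof.
move=> q0 q1 q2 [[|[|[|i]]] //= lt3].
- by rewrite (_ : Ordinal lt3 = o0) //; apply: val_inj.
- by rewrite (_ : Ordinal lt3 = o1) //; apply: val_inj.
- by rewrite (_ : Ordinal lt3 = o2) //; apply: val_inj.
Qed.

(** * Failure of both properties when [a] or [b] is nonzero *)

Section NonRegular.
Variables (M : 'X_{1..3}) (a b c : int).
Hypothesis MP : M = mon 1 1 0 \/ M = mon 0 2 0.
Local Notation P := (quadric M a b c).
Hypotheses (abc0 : a * b * c = 0) (s0 : a + b + c != 0).
Hypothesis ab0 : (a != 0) || (b != 0).

(* If a linear monomial has minimal weight then no quadratic one does, and the
   leading coefficient is a partial sum of [a, b, c], nonzero because one of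
   them vanishes. Otherwise exactly one quadratic monomial has minimal weight. *)
Lemma leading_form_quadric_neq0 (p : nat) (t : 'I_3 -> nat) (w : 'F_p) :
    prime p -> (`|a| + `|b| + `|c| < p)%N ->
    (forall i, (0 < t i)%N) -> (forall i j, t j <> (2 * t i)%N) -> w != 0 ->
  leading_form P t w != 0.
Proof.
move=> p_pr p_gt tpos tne w0.
have [[alpha Palpha lev] lev_min] := level0P t (quadric_neq0 a b c MP).
have lev_mon i j k : P@_(mon i j k) != 0 ->
    (level P t 0 <= t o0 * i + (t o1 * j + t o2 * k))%N.
  by rewrite -mcoeff_msupp -poslin_mon; apply: lev_min.
have lev_M : (level P t 0 <= poslin t M)%N.
  by apply: lev_min; rewrite mcoeff_msupp; case: (quadric_coefs a b c MP) => _ ->.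
have [e1 _ e3 e4 e5] := quadric_coefs a b c MP.
have {lev_mon} := (lev_mon 2 0 0, lev_mon 1 0 0, lev_mon 0 1 0, lev_mon 0 0 1)%N.
rewrite e1 e3 e4 e5 !muln0 !addn0 !add0n !muln1 => -[[[l1 l3] l4] l5].
have {l1} := l1 isT.
have {lev} attained : [|| t o0 * 2 == level P t 0, poslin t M == level P t 0,
    (a != 0) && (t o0 == level P t 0), (b != 0) && (t o1 == level P t 0)
    | (c != 0) && (t o2 == level P t 0)]%N.
  have := msupp_quadric Palpha; move: Palpha; rewrite mcoeff_msupp !inE -lev.
  by move=> + /or4P[|||/orP[]]/eqP E; rewrite E ?e3 ?e4 ?e5 ?poslin_mon
    ?muln0 ?addn0 ?add0n ?muln1 ?eqxx ?orbT // => ->; rewrite ?orbT.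
rewrite leading_form_quadricE //; clear e1 e3 e4 e5 lev_min alpha Palpha.
move: (level P t 0) lev_M l3 l4 l5 attained => L lev_M l3 l4 l5 attained l1.
have [[t0 t1] t2] := (tpos o0, tpos o1, tpos o2).
have tM : poslin t M = (t o0 + t o1)%N \/ poslin t M = (t o1 * 2)%N.
  by case: MP => ->; rewrite poslin_mon !muln0 !addn0 ?muln1; [left | right].
have [[[n01 n02] n10] n12] := (tne o0 o1, tne o0 o2, tne o1 o0, tne o1 o2).
have nz (z : int) : (`|z| < p)%N -> z != 0 -> z%:~R * w != 0.
  move=> zp z0; rewrite mulf_neq0 // intr_Fp_eq0 //.
  by rewrite gtnNdvd // lt0n absz_eq0.
have [lin|] := boolP [|| (a != 0) && (t o0 == L), (b != 0) && (t o1 == L)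
    | (c != 0) && (t o2 == L)].
  (* Each of [2 * t o0] and [2 * t o1] either exceeds [L] or differs from it by the exclusion of
     doubled weights. The sum [t o0 + t o1] exceeds [L] because [x] or [y] has weight at least
     [L]. *)
  have [q1 q2] : ((t o0 * 2)%N != L) /\ (poslin t M != L).
    case/or3P: lin => /andP[z0 /eqP tL]; last case/orP: ab0 => [/l3|/l4] lt2.
    + by clear -tL t0 t1 tM n10; lia.
    + by clear -tL t0 t1 tM n01; lia.
    + by clear -tL t0 t1 tM n02 n12 lt2; lia.
    + by clear -tL t0 t1 tM n02 n12 lt2; lia.
  rewrite (negPf q1) (negPf q2) !mul0r subrr add0r; apply: nz.
    by clear -p_gt; do 3 case: (_ == L); lia.
  have /eqP := abc0; rewrite !mulf_eq0 -orbA => /or3P[]/eqP z0.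
  - clear -s0 lin z0.
    by case: (t o0 == L) lin; case: (t o1 == L); case: (t o2 == L); lia.
  - clear -s0 lin z0.
    by case: (t o0 == L) lin; case: (t o1 == L); case: (t o2 == L); lia.
  - clear -s0 lin z0.
    by case: (t o0 == L) lin; case: (t o1 == L); case: (t o2 == L); lia.
rewrite 2!negb_or => /and3P[nl3 nl4 nl5].
have -> : (t o0 == L)%:R * a + (t o1 == L)%:R * b + (t o2 == L)%:R * c = 0.
  clear -nl3 nl4 nl5.
  by case: (t o0 == L) nl3; case: (t o1 == L) nl4; case: (t o2 == L) nl5; lia.
rewrite (negPf nl3) (negPf nl4) (negPf nl5) !orbF in attained.
rewrite mulr0z mul0r addr0.
have [q1|q1] := eqVneq (t o0 * 2)%N L; have [q2|q2] := eqVneq (poslin t M) L.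
(* Both quadratic terms at level [L] would force [t o0 = t o1 = L / 2], but [x] or [y] occurs in [P]
   and so has weight at least [L]. *)
- exfalso; case/orP: ab0 => [/l3|/l4] lt;
    clear -q1 q2 lt tM t0 t1; lia.
- by rewrite mul1r mul0r subr0 expf_neq0.
- by rewrite mul1r mul0r sub0r oppr_eq0 expf_neq0.
- by rewrite (negPf q1) (negPf q2) in attained.
Qed.

Lemma quadric_not_partition_regular : ~ partition_regular P.
Proof.
have [p p_gt p_pr] := prime_above (`|a| + `|b| + `|c|)%N.
(* Divisibility by [p] is recorded separately because [parity_coloring] excludes doubled exponents
   only among positive ones. *)
pose col (m : nat) := enum_rank ((m %/ p ^ logn p m)%N%:R : 'F_p,
  (p %| m)%N, parity_coloring (logn p m)).
move=> /(_ _ col) /infinite_setN0[_ [x [[xpos xmono] Px] _]].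
have {}xpos i : (0 < x i)%N by apply: xpos; exists i.
have {}xmono i : col (x i) = col (x o0) by apply: xmono; [exists i | exists o0].
pose t i := logn p (x i); pose u i := (x i %/ p ^ t i)%N.
have xE i : x i = (p ^ t i * u i)%N by rewrite mulnC divnK ?pfactor_dvdnn.
have [uw pdvd par] : [/\ forall i, (u i)%:R = (u o0)%:R :> 'F_p,
    forall i, (p %| x i)%N = (p %| x o0)%N
    & forall i, parity_coloring (t i) = parity_coloring (t o0)].
  by split=> i; have /enum_rank_inj[] := xmono i.
have w0 : (u o0)%:R != 0 :> 'F_p.
  rewrite -[_%:R]/(_%:Z%:~R) intr_Fp_eq0 // /u /t.
  have [m pm xm] := pfactor_coprime p_pr (xpos o0).
  rewrite [X in (X %/ _)%N]xm mulnK ?expn_gt0 ?prime_gt0 //.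
  by rewrite absz_nat -prime_coprime.
have lead0 : leading_form P t ((u o0)%:R : 'F_p) = 0.
  apply: (meval_prime_power (u := u)) => //; first exact: quadric_neq0.
  rewrite -[RHS]Px; congr (meval _ _); apply: funext => i; rewrite -xE //.
have [px|npx] := boolP (p %| x o0)%N.
  have tpos i : (0 < t i)%N by rewrite logn_gt0 mem_primes p_pr xpos pdvd.
  have tne i j : t j <> (2 * t i)%N.
    by apply: parity_coloring_double => //; rewrite !par.
  have := leading_form_quadric_neq0 p_pr p_gt tpos tne w0.
  by rewrite lead0 eqxx.
(* Now every monomial has weight 0, the quadratic terms cancel, and [(a + b + c) * w] remains, with
   [|a + b + c| < p]. *)
have t0 i : t i = 0%N by rewrite /t logn_coprime // prime_coprime // pdvd.
have pos0 alpha : poslin t alpha = 0%N by rewrite /poslin big1 // => i _; rewrite t0.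
have L0 : level P t 0 = 0%N.
  by have [[alpha _ <-] _] := level0P t (quadric_neq0 a b c MP).
move/eqP: lead0; rewrite leading_form_quadricE // L0 !t0 pos0 eqxx.
rewrite subrr add0r !mul1r mulf_eq0 (negPf w0) orbF intr_Fp_eq0 // gtnNdvd //.
  by rewrite lt0n absz_eq0.
clear -p_gt; lia.
Qed.

Lemma quadric_not_minimal_rado : ~ minimal_rado_condition P.
Proof.
have [p p_gt p_pr] := prime_above (`|a| + `|b| + `|c|)%N.
case=> _ _ /(_ p p_pr) [r [J [d [rootr + [w [wu]]]]]].
have r0 : r = 0.
  move: rootr; rewrite mdiag_quadric // rootE hornerCM hornerX mulf_eq0.
  by rewrite (negPf s0) => /eqP.
rewrite {}r0 mshift0 => rado sum0.
have [t [w' [w'0 tpos tne lead0]]] :=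
  rado_leading_form p_pr (quadric_neq0 a b c MP) rado wu sum0.
have := leading_form_quadric_neq0 p_pr p_gt tpos tne w'0.
by rewrite lead0 eqxx.
Qed.

End NonRegular.

(* Giving each number of a finite set its own color forces a monochromatic
   solution inside that set to be constant. *)
Lemma partition_regularW (n : nat) (P : {mpoly int[n.+1]}) :
    (forall m, (0 < m)%N -> P.@[fun=> m%:Z] != 0) ->
    (forall (k : nat) (c : nat -> 'I_k), exists2 x : 'I_n.+1 -> nat,
      monochromatic c (range x) & P.@[fun i => (x i)%:Z] = 0) ->
  partition_regular P.
Proof.
move=> nconst sol k c finA; set A := (X in finite_set X) in finA.
have finU : finite_set (\bigcup_(X in A) X).
  apply: bigcup_finite => // _ [x _ <-].
  by apply: finite_image; apply: finite_finset.
(* Finitely many solution sets are assumed, each of them finite, so one [N] bounds all their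
   members. *)
have [N HN] : exists N,
    forall (x : 'I_n.+1 -> nat) i, A (range x) -> (x i <= N)%N.
  have /finite_seqP[s sE] := finU; exists (\max_(m <- s) m)%N => x i Ax.
  apply: (@leq_bigmax_seq _ s xpredT id) => //.
  have : (\bigcup_(X in A) X) (x i) by exists (range x) => //; exists i.
  by rewrite sE.
pose c' m := enum_rank
  (if (m <= N)%N then inl (inord m) else inr (c m) : 'I_N.+1 + 'I_k).
have c'P m m' : c' m = c' m' -> (m <= N)%N /\ m = m' \/ c m = c m'.
  move/enum_rank_inj; case: leqP => mN; case: leqP => m'N // -[].
    by move/(congr1 (@nat_of_ord _)); rewrite !inordK //; left.
  by right.
have [x [xpos xmono] Px] := sol _ c'.
have Ax : A (range x).
  exists x => //; split=> //; split=> // m m' xm xm'.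
  by have /c'P[[_ ->]|] := xmono _ _ xm xm'.
have xconst i : x i = x ord0.
  have: c' (x i) = c' (x ord0) by apply: xmono; [exists i | exists ord0].
  move/enum_rank_inj; rewrite !HN // => -[].
  by move/(congr1 (@nat_of_ord _)); rewrite !inordK // ltnS HN.
have /negP[] := nconst _ (xpos _ (ex_intro2 _ _ ord0 I erefl)).
by rewrite -Px; apply/eqP; congr (meval _ _); apply: funext => i; rewrite xconst.
Qed.

(** * Partition regularity when [a = b = 0] *)

Section Regular.
Variables (M : 'X_{1..3}) (c : int).
Hypothesis MP : M = mon 1 1 0 \/ M = mon 0 2 0.
Hypothesis c0 : c != 0.
Local Notation P := (quadric M 0 0 c).

Lemma meval_quadric (v : 'I_3 -> int) :
  P.@[v] = v o0 ^+ 2 - 'X_[M].@[v] + c * v o2.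
Proof.
rewrite /quadric !scale0r !addr0 mevalD mevalB mevalZ !meval_mon.
by rewrite !expr0 !expr1 !mulr1 !mul1r.
Qed.

Lemma quadric_partition_regular : partition_regular P.
Proof.
have solE (k : nat) (col : nat -> 'I_k) (x y z : int) (e : 'I_k) :
    [/\ 0 < x, 0 < y, 0 < z
      & [/\ col `|x|%N = e, col `|y|%N = e & col `|z|%N = e]] ->
    (forall v : 'I_3 -> int, v o0 = x -> v o1 = y -> v o2 = z -> P.@[v] = 0) ->
    exists2 u : 'I_3 -> nat,
      monochromatic col (range u) & P.@[fun i => (u i)%:Z] = 0.
  move=> [x0 y0 z0 [ex ey ez]] Pv.
  exists (fun i => nth 0%N [:: `|x|; `|y|; `|z|]%N i).
    have H : forall i : 'I_3, (0 < nth 0%N [:: `|x|; `|y|; `|z|]%N i)%N /\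
        col (nth 0%N [:: `|x|; `|y|; `|z|]%N i) = e.
      by apply: forall_I3; split=> //=; rewrite absz_gt0 gt_eqF.
    split=> [_ [i _ <-]|_ _ [i _ <-] [j _ <-]]; first by case: (H i).
    by case: (H i) => _ ->; case: (H j) => _ ->.
  by apply: Pv; rewrite /= gez0_abs // ltW.
apply: partition_regularW => [m m0|k col].
  (* At a constant point the quadratic terms cancel and [c * m] remains. *)
  rewrite meval_quadric; case: MP => ->; rewrite meval_mon;
    clear -c0 m0; rewrite !expr0 ?expr1 ?mulr1 ?mul1r; nia.
case: MP => MP'.
  have [x [v [x0 v0 cq /(_ c)]]] :=
    monochromatic_affine_pattern (fun z : int => col `|z|%N) [:: c]
      (isT : (0 < 1)%N).
  rewrite inE eqxx => /(_ isT)[xcv0 cc].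
  apply: (solE _ col x (x + c * v) (1%:Z * x * v) (col `|x|%N)).
    split=> //; by rewrite mul1r mulr_gt0.
  move=> u e0 e1 e2; rewrite meval_quadric MP' meval_mon e0 e1 e2; ring.
(* The factor 4 comes from [(x + cv)^2 - (x - cv)^2 = 4cxv]. *)
have [x [v [x0 v0 cq Hf]]] :=
  monochromatic_affine_pattern (fun z : int => col `|z|%N) [:: c; - c]
    (isT : (0 < 4)%N).
have [|p1 e1] := Hf c; first by rewrite inE eqxx.
have [|p2 e2] := Hf (- c); first by rewrite !inE eqxx orbT.
apply: (solE _ col (x + - c * v) (x + c * v) (4%:Z * x * v) (col `|x|%N)).
  by split=> //; rewrite !mulr_gt0.
move=> u E0 E1 E2; rewrite meval_quadric MP' meval_mon E0 E1 E2; ring.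
Qed.

End Regular.

(** * The minimal Rado condition when [a = b = 0] *)

(** If each color were absent from some point on, a number beyond all these finitely many points
    would have no color. *)
Lemma recurring_color (r : nat) (col : nat -> 'I_r) :
  exists2 s, (0 < s)%N & forall N, exists2 u, (N < u)%N & col u = col s.
Proof.
apply: contrapT => none.
have /choice[N HN] : forall e : 'I_r, exists N, forall u, (N < u)%N -> col u <> e.
  move=> e; have [[s s0 se]|ne] := pselect (exists2 s, (0 < s)%N & col s = e).
    apply: contrapT => nN; apply: none; exists s => // N.
    apply: contrapT => nu; apply: nN; exists N => u Nu eu.
    by apply: nu; exists u => //; rewrite eu se.
  by exists 0%N => u u0 eu; apply: ne; exists u.
pose u := (\max_e N e).+1; apply: (HN (col u) u) => //.
by rewrite ltnS leq_bigmax.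
Qed.

Section MinimalRado.
Variables (M : 'X_{1..3}) (c : int).
Hypothesis MP : M = mon 1 1 0 \/ M = mon 0 2 0.
Hypothesis c0 : c != 0.
Local Notation P := (quadric M 0 0 c).

Lemma msupp_quadric00 : msupp P =i [:: mon 2 0 0; M; mon 0 0 1].
Proof.
move=> alpha; have [e1 e2 e3 e4 e5] := quadric_coefs 0 0 c MP.
apply/idP/idP => [Pa|].
  have := msupp_quadric Pa; move: Pa; rewrite mcoeff_msupp !inE.
  by move=> + /or4P[|||/orP[]]/eqP E; rewrite E ?e3 ?e4 ?eqxx ?orbT.
rewrite !inE mcoeff_msupp => /or3P[]/eqP->; by rewrite ?e1 ?e2 ?e5.
Qed.

Lemma quadric_determined_partition (t : 'I_3 -> nat) :
    t o0 = t o1 -> (2 * t o0 < t o2)%N ->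
  levels P t = [:: 2 * t o0; t o2]%N /\
  determined_partition P t = [:: [fset mon 2 0 0; M]; [fset mon 0 0 1]]%fset.
Proof.
move=> t01 t02.
have pl1 : poslin t (mon 2 0 0) = (2 * t o0)%N by rewrite poslin_mon; lia.
have pl2 : poslin t M = (2 * t o0)%N by case: MP => ->; rewrite poslin_mon; lia.
have pl3 : poslin t (mon 0 0 1) = (t o2)%N by rewrite poslin_mon; lia.
have levE : levels P t = [:: 2 * t o0; t o2]%N.
  apply: (irr_sorted_eq ltn_trans ltnn).
  - rewrite ltn_sorted_uniq_leq sort_uniq undup_uniq /=.
    exact: (sort_sorted leq_total).
  - by rewrite /= t02.
  move=> x; rewrite mem_sort mem_undup (eq_mem_map _ msupp_quadric00) /=.
  by rewrite !inE pl1 pl2 pl3 orbA orbb.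
split=> //; rewrite /determined_partition levE /=.
have ne1 : (2 * t o0 == t o2)%N = false by lia.
have ne2 : (t o2 == 2 * t o0)%N = false by lia.
congr [:: _; _]; apply/fsetP => alpha; rewrite !inE /= msupp_quadric00 !inE.
  apply/andP/orP => [[/or3P[]/eqP->]|[]/eqP->].
  - by left.
  - by right.
  - by rewrite pl3 ne2.
  - by rewrite pl1 !eqxx.
  - by rewrite pl2 !eqxx orbT.
apply/andP/eqP => [[/or3P[]/eqP-> //]|->].
- by rewrite pl1 ne1.
- by rewrite pl2 ne1.
- by rewrite pl3 !eqxx !orbT.
Qed.

(** With [d] empty, the only gap condition is [M_1 - M_0 >= k]. The weights [(s, s, u)] have levels
    [2s] and [u], and a recurring color allows arbitrarily large [u], hence infinitely many
    choices. *)
Lemma quadric_minimal_rado_functional :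
  minimal_rado_functional P [:: [fset mon 2 0 0; M]; [fset mon 0 0 1]]%fset [::].
Proof.
split=> // r col k finB; set B := (X in finite_set X) in finB.
have [s s0 Hs] := recurring_color col.
have /finite_seqP[l lE] : finite_set [set t o2 | t in B] by apply: finite_image.
have [u] := Hs (maxn (\max_(m <- l) m) (2 * s + k))%N.
rewrite gtn_max => /andP[lu su] colu.
pose t (i : 'I_3) := nth 0%N [:: s; s; u] i.
have Bt : B t.
  have [levE partE] : levels P t = [:: 2 * s; u]%N /\
    determined_partition P t = [:: [fset mon 2 0 0; M]; [fset mon 0 0 1]]%fset.
    by apply: quadric_determined_partition => //; rewrite /t /=; lia.
  have H : forall i, (0 < t i)%N /\ col (t i) = col s.
    by apply: forall_I3; rewrite /t /=; split=> //; lia.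
  split=> //.
    split=> [_ [i _ <-]|_ _ [i _ <-] [j _ <-]]; first by case: (H i).
    by case: (H i) => _ ->; case: (H j) => _ ->.
  by move=> _; rewrite /level levE /= ltnW.
have : [set t o2 | t in B] u by exists t.
rewrite lE /= => ul; have := @leq_bigmax_seq _ l xpredT id u ul isT.
by rewrite leqNgt lu.
Qed.

Lemma quadric_minimal_rado : minimal_rado_condition P.
Proof.
have dE : mdiag P = c%:P * 'X by rewrite mdiag_quadric // !add0r.
split.
- by rewrite dE mulf_neq0 ?polyC_eq0 ?polyX_eq0.
- by exists c, [:: 'X]; rewrite big_seq1 dE mul_polyC /= size_polyX.
move=> p p_pr; exists 0, [:: [fset mon 2 0 0; M]; [fset mon 0 0 1]]%fset, [::].
split.
- by rewrite dE rootE hornerCM hornerX mulr0.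
- by rewrite mshift0; apply: quadric_minimal_rado_functional.
(* The coefficients on [J_0] are 1 and -1, both in degree 2, so they cancel at [w = 1]. *)
exists 1; split; first by exists 1; rewrite mulr1.
rewrite big_ord1 /= expn0 mul1r.
have nM : M != mon 2 0 0 by case: MP => ->; rewrite mon_eq.
have [e1 e2 _ _ _] := quadric_coefs 0 0 c MP.
rewrite (perm_big [:: mon 2 0 0; M]) /=; last first.
  apply: uniq_perm; rewrite ?fset_uniq //= ?inE ?andbT 1?eq_sym //.
  by move=> alpha; rewrite !inE.
by rewrite big_cons big_seq1 !taylor_coefE !mshift0 e1 e2 !expr1n !mulr1 mulrN1z subrr.
Qed.

End MinimalRado.

(** * Constant solutions and the case distinction *)

Lemma quadric_statement (P : {mpoly int[3]}) (a b c : int) :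
    let x : {mpoly int[3]} := 'X_o0 in
    let y : {mpoly int[3]} := 'X_o1 in
    let z : {mpoly int[3]} := 'X_o2 in
    P = x ^+ 2 - x * y + a *: x + b *: y + c *: z \/
    P = x ^+ 2 - y ^+ 2 + a *: x + b *: y + c *: z ->
  exists2 M, M = mon 1 1 0 \/ M = mon 0 2 0 & P = quadric M a b c.
Proof.
by move=> x y z [|] ->; [exists (mon 1 1 0) | exists (mon 0 2 0)]; auto;
  rewrite /quadric !mpolyX_mon !expr0 !expr1 !mulr1 !mul1r.
Qed.

(** The value of [P] at a constant point is that of its diagonal polynomial, so every singleton of a
    positive integer is a monochromatic solution set. *)
Lemma constant_partition_regular (n : nat) (P : {mpoly int[n.+1]}) :
  mdiag P = 0 -> partition_regular P.
Proof.
move=> dP0 k col.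
have Pconst m : P.@[fun=> m%:Z] = 0.
  have := congr1 (horner^~ m%:Z) dP0; rewrite horner0 => <-.
  rewrite /mdiag /mmap horner_sum mevalE; apply: eq_bigr => alpha _.
  rewrite hornerCM /mmap1 horner_prod; congr (_ * _).
  by apply: eq_bigr => i _; rewrite hornerXn.
set A := (X in infinite_set X).
have AS m : A [set m.+1].
  exists (fun=> m.+1).
    by split=> //; split=> [_ [_ _ <-] //|_ _ [_ _ <-] [_ _ <-] //].
  by apply/seteqP; split=> [_ [_ _ <-] //|_ ->]; exists ord0.
move=> finA; apply: infinite_nat.
rewrite (_ : setT = (fun m => [set m.+1]) @^-1` A).
  apply: finite_preimage finA => m m' _ _ e.
  by have : [set m'.+1] m.+1 by [rewrite -e]; case.
by apply/seteqP; split=> m // _; apply: AS.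
Qed.

Theorem theorem2p21 (a b c : int) (habc : a * b * c = 0 \/ a + b + c = 0)
    (P : {mpoly int[3]})
    (hP : let x : {mpoly int[3]} := 'X_(@Ordinal 3 0 isT) in
          let y : {mpoly int[3]} := 'X_(@Ordinal 3 1 isT) in
          let z : {mpoly int[3]} := 'X_(@Ordinal 3 2 isT) in
          P = x ^+ 2 - x * y + a *: x + b *: y + c *: z \/
          P = x ^+ 2 - y ^+ 2 + a *: x + b *: y + c *: z) :
  partition_regular P <-> (mdiag P = 0 \/ minimal_rado_condition P).
Proof.
have [M MP ->] := quadric_statement hP.
have [s0|s0] := eqVneq (a + b + c) 0.
  have d0 : mdiag (quadric M a b c) = 0 by rewrite mdiag_quadric // s0 mul0r.
  by split=> _; [left | apply: constant_partition_regular].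
have abc0 : a * b * c = 0 by case: habc => // s0'; rewrite s0' eqxx in s0.
have [ab0|] := boolP ((a != 0) || (b != 0)).
  split=> [/(quadric_not_partition_regular MP abc0 s0 ab0) //|].
  case=> [/eqP|/(quadric_not_minimal_rado MP abc0 s0 ab0) //].
  by rewrite mdiag_quadric // mulf_eq0 polyC_eq0 (negPf s0) polyX_eq0.
rewrite negb_or !negbK => /andP[/eqP a0 /eqP b0]; subst a b.
rewrite !add0r in s0; split=> _; last exact: quadric_partition_regular.
by right; apply: quadric_minimal_rado.
Qed.
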